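(* Let $R$ be a ring and suppose that $S_r\subseteq J(R)$, where $S_r$ denotes the right socle of $R$ and $J(R)$ the Jacobson radical of $R$. Then $R$ is $\delta$-reversible if and only if $R$ is $J$-reversible.
   Context: All rings are associative with identity. $S_r=\mathrm{Soc}(R_R)$ is the sum of all minimal right ideals of $R$. A submodule $N$ of a right module $M$ is $\delta$-small in $M$ if whenever $M=N+L$ with $M/L$ singular, then $M=L$. The Zhou radical $\delta(R)$ is the sum of all $\delta$-small right ideals of $R$; equivalently, $\delta(R)$ is the intersection of all essential maximal right ideals of $R$ (with $\delta(R)=R$ if there are none). It is a two-sided ideal of $R$. A ring $R$ is $\delta$-reversible if for all $a,b\in R$, $ab=0$ implies $ba\in\delta(R)$. A ring $R$ is $J$-reversible if for all $a,b\in R$, $ab=0$ implies $ba\in J(R)$. *)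

(* Defs.v *)
From HB Require Import structures.
From mathcomp Require Import all_boot all_order all_algebra.
From mathcomp Require Import boolp classical_sets.

Set Implicit Arguments.
Unset Strict Implicit.
Unset Printing Implicit Defensive.

Import GRing.Theory.

Local Open Scope classical_set_scope.
Local Open Scope ring_scope.

(* A right R-module is a left module over the converse ring R^c, and R_R is   *)
(* (R^c)^o: scaling x by r there is x * r in R (rreg_scaleE below).  Rings    *)
(* are pzRingType, so the zero ring is allowed.                               *)
Notation rmodType R := (lmodType R^c).
Notation rreg R := ((R^c)^o).

Lemma rreg_scaleE (R : pzRingType) (r x : R) :
  (r : R^c) *: (x : rreg R) = x * r :> R.
Proof. by []. Qed.

Section RightModules.
Variables (R : pzRingType) (M : rmodType R).
Implicit Types (N L K : set M) (F : set (set M)).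

Definition submodule N : Prop := submod_closed [in N].

Definition sum_family F : set M :=
  [set x | exists2 s : seq M,
     (forall y, y \in s -> exists2 N, F N & N y) & x = \sum_(y <- s) y].

Definition essential N : Prop :=
  submodule N /\
  forall K, submodule K -> K `&` N = [set 0] -> K = [set 0].

Definition minimal_submodule N : Prop :=
  [/\ submodule N, N <> [set 0] &
      forall K, submodule K -> K `<=` N -> K = [set 0] \/ K = N].

Definition maximal_submodule N : Prop :=
  [/\ submodule N, N <> setT &
      forall K, submodule K -> N `<=` K -> K = N \/ K = setT].

(* The right annihilator in R of the element m + L of the quotient M / L.     *)
Definition coset_ann L (m : M) : set (rreg R) :=
  [set r | L ((r : R^c) *: m)].

End RightModules.

(* M / L is singular: the annihilator of each of its elements is an essential *)
(* right ideal of R.                                                          *)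
Definition singular_quotient (R : pzRingType) (M : rmodType R) (L : set M) :
    Prop :=
  forall m : M, @essential R (rreg R) (coset_ann L m).

Definition delta_small (R : pzRingType) (M : rmodType R) (N : set M) : Prop :=
  submodule N /\
  forall L : set M, submodule L ->
    [set x + y | x in N & y in L] = setT -> singular_quotient L -> L = setT.

Definition right_socle (R : pzRingType) : set R :=
  @sum_family R (rreg R) (@minimal_submodule R (rreg R)).

Definition jacobson_radical (R : pzRingType) : set R :=
  \bigcap_(I in @maximal_submodule R (rreg R)) I.

Definition zhou_radical (R : pzRingType) : set R :=
  @sum_family R (rreg R) (@delta_small R (rreg R)).

Arguments right_socle R : clear implicits.
Arguments jacobson_radical R : clear implicits.
Arguments zhou_radical R : clear implicits.

Definition delta_reversible (R : pzRingType) : Prop :=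
  forall a b : R, a * b = 0 -> zhou_radical R (b * a).

Definition J_reversible (R : pzRingType) : Prop :=
  forall a b : R, a * b = 0 -> jacobson_radical R (b * a).

(* Main.v *)
Require Import Defs.
From mathcomp Require Import all_boot all_order all_algebra.
From mathcomp Require Import boolp classical_sets.

(** Under the hypothesis the two radicals coincide.  A right ideal inside
    [J(R)] is small, hence delta-small.  Conversely, let [I] be a maximal right
    ideal and [N] a delta-small one.  If [I] is essential then [R / I] is
    singular, so [N + I = R] is impossible and [N] lies in [I].  If [I] is not
    essential, a nonzero right ideal [K] with [K :&: I = 0] is a complement of
    [I], hence minimal, so [K] lies in the right socle and therefore in
    [J(R)], hence in [I]: a contradiction. *)

Set Implicit Arguments.
Unset Strict Implicit.
Unset Printing Implicit Defensive.

Import GRing.Theory.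

Local Open Scope classical_set_scope.
Local Open Scope ring_scope.

Section Submodules.
Variables (R : pzRingType) (M : rmodType R).
Implicit Types (N L K : set M).

(** Trades the boolean membership in [submod_closed] for plain propositions, the form that the
    closure arguments below work with. *)
Lemma submoduleP N : submodule N <->
  N 0 /\ forall (a : R^c) u v, N u -> N v -> N (a *: u + v).
Proof.
split=> -[N0 NS]; split=> [|a u v]; rewrite ?inE //.
- by move: N0; rewrite inE.
- by move=> Nu Nv; have := NS a u v; rewrite !inE; apply.
- exact: NS.
Qed.

Lemma submodule0 N : submodule N -> N 0.
Proof. by move=> /submoduleP[]. Qed.

Lemma submoduleZD N (a : R^c) u v :
  submodule N -> N u -> N v -> N (a *: u + v).
Proof. by move=> /submoduleP[_]; apply. Qed.

Lemma submoduleD N u v : submodule N -> N u -> N v -> N (u + v).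
Proof. by move=> sN Nu Nv; rewrite -[u]scale1r; apply: submoduleZD. Qed.

Lemma submoduleZ N (a : R^c) u : submodule N -> N u -> N (a *: u).
Proof.
by move=> sN Nu; rewrite -[_ *: _]addr0; exact: submoduleZD (submodule0 sN).
Qed.

Lemma submoduleB N u v : submodule N -> N u -> N v -> N (u - v).
Proof.
by move=> sN Nu Nv; rewrite -scaleN1r addrC; apply: submoduleZD.
Qed.

Lemma submodule_add N L : submodule N -> submodule L ->
  submodule [set x + y | x in N & y in L].
Proof.
move=> sN sL; apply/submoduleP; split.
  by exists 0; [exact: submodule0|exists 0; [exact: submodule0|rewrite addr0]].
move=> a _ _ [x Nx [y Ly <-]] [x' Nx' [y' Ly' <-]].
exists (a *: x + x'); first exact: submoduleZD.
exists (a *: y + y'); first exact: submoduleZD.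
by rewrite scalerDr addrACA.
Qed.

Lemma maximal_addT N K : maximal_submodule N -> submodule K -> ~ K `<=` N ->
  [set x + y | x in K & y in N] = setT.
Proof.
move=> [sN _ maxN] sK nKN.
have /maxN[|eqN|//] := submodule_add sK sN.
  by move=> y Ny; exists 0; [exact: submodule0|exists y; rewrite ?add0r].
case: nKN => x Kx; rewrite -eqN.
by exists x => //; exists 0; [exact: submodule0|rewrite addr0].
Qed.

(** A submodule [H] of [K] that lies in [N] is zero. Otherwise [H + N] is the whole module, and the
    modular law turns this into [H = K]. *)
Lemma maximal_complement_minimal N K : maximal_submodule N -> submodule K ->
  K <> [set 0] -> K `&` N = [set 0] -> minimal_submodule K.
Proof.
move=> maxN sK K0 KN0; split=> // H sH HK.
have [HN|nHN] := pselect (H `<=` N); [left|right]; apply/seteqP; split=> //.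
- by move=> x Hx; rewrite -KN0; split; [exact: HK|exact: HN].
- by move=> _ ->; exact: submodule0.
move=> x Kx.
have [y Hy [z Nz yzx]] : [set x + y | x in H & y in N] x.
  by rewrite (maximal_addT maxN sH nHN).
(* The [N]-component [z = x - y] also lies in [K], since [x] and [y] do, so it vanishes and [x = y]
   is in [H]. *)
suff : [set 0] z by move=> z0; rewrite -yzx z0 addr0.
rewrite -KN0; split=> //.
by rewrite -[z](addKr y) yzx addrC; apply: submoduleB => //; exact: HK.
Qed.

Lemma sum_family_sub (F : set (set M)) N : submodule N ->
  (forall K, F K -> K `<=` N) -> sum_family F `<=` N.
Proof.
move=> sN FN _ [s sF ->]; elim: s sF => [|y s IH] sF.
  by rewrite big_nil; exact: submodule0.
rewrite big_cons; apply: submoduleD => //.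
  by have [|K FK Ky] := sF y; rewrite ?mem_head //; exact: FN Ky.
by apply: IH => z zs; apply: sF; rewrite inE zs orbT.
Qed.

Lemma sub_sum_family (F : set (set M)) N : F N -> N `<=` sum_family F.
Proof.
move=> FN x Nx; exists [:: x]; last by rewrite big_seq1.
by move=> y; rewrite inE => /eqP ->; exists N.
Qed.

End Submodules.

Section SingularQuotient.
Variables (R : pzRingType) (M : rmodType R).
Implicit Types L : set M.

Lemma submodule_coset_ann L (m : M) : submodule L -> submodule (coset_ann L m).
Proof.
move=> sL; apply/submoduleP; split=> [|a u v Lu Lv].
  by rewrite /coset_ann /= scale0r; exact: submodule0.
rewrite /coset_ann /= scalerDl.
by apply: submoduleD => //; rewrite -scalerA; apply: submoduleZ.
Qed.

(** Suppose that [K] meets the annihilator of [m + L] only in 0. Then [k *: m] can lie in [L] only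
    for [k = 0], so the image [mK] of [K] meets [L] trivially. Essentiality makes [mK] zero, which
    forces [K] to be zero. *)
Lemma essential_singular_quotient L : essential L -> singular_quotient L.
Proof.
move=> [sL essL] m; split=> [|K sK Kann0]; first exact: submodule_coset_ann.
have mul0 (k : R^c) : K k -> L (k *: m) -> k = 0.
  move=> Kk Lk; have : (K `&` coset_ann L m) k := conj Kk Lk.
  by rewrite Kann0.
pose mK : set M := [set (k : R^c) *: m | k in K].
have smK : submodule mK.
  apply/submoduleP; split; first by exists 0; [exact: submodule0|rewrite scale0r].
  move=> a _ _ [k Kk <-] [l Kl <-]; exists (a *: k + l); first exact: submoduleZD.
  by rewrite scalerDl scalerA.
have mK0 : mK = [set 0].
  apply: essL => //; apply/seteqP; split=> [_ [[k Kk <-] Lmk]|_ ->].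
    by rewrite (mul0 k) //= scale0r.
  by split; apply: submodule0.
apply/seteqP; split=> [k Kk|_ ->]; last exact: submodule0.
apply: mul0 => //.
have : mK ((k : R^c) *: m) by exists k.
by rewrite mK0 => ->; exact: submodule0.
Qed.

End SingularQuotient.

Section RightIdeals.
Variable R : pzRingType.
Implicit Types (I L K N : set (rreg R)).

Lemma right_ideal1 L : submodule L -> L 1 -> L = setT.
Proof.
move=> sL L1; apply/seteqP; split=> // x _.
have := submoduleZ (x : R^c) sL L1.
by rewrite rreg_scaleE mul1r.
Qed.

(** Zorn's lemma applies because properness of a right ideal means omitting 1, a condition that
    survives unions of chains. *)
Lemma proper_sub_maximal L : submodule L -> L <> setT ->
  exists2 I, maximal_submodule I & L `<=` I.
Proof.
move=> sL LT; have nL1 : ~ L 1 by move=> /(right_ideal1 sL).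
(* [L] is joined to every set so that the empty chain also has a bound. *)
pose P (A : set (rreg R)) := submodule (L `|` A) /\ ~ (L `|` A) 1.
have [F FP totF|I [[sLI nLI1] maxI]] := @Zorn_bigcup (rreg R) P.
  (* Any two elements of the union already lie in a single right ideal [L] joined to [A], so closure
     and omission of 1 can be checked there. If both come from [L], the choice [A = set0] works even
     when [F] is empty. *)
  have in_chain x y : (L `|` \bigcup_(A in F) A) x ->
      (L `|` \bigcup_(A in F) A) y ->
      exists A, [/\ P A, A `<=` \bigcup_(A in F) A,
                    (L `|` A) x & (L `|` A) y].
    move=> [Lx|[A FA Ax]] [Ly|[B FB By]].
    - by exists set0; split; [rewrite /P setU0|exact: sub0set|left|left].
    - by exists B; split;
        [exact: FP|exact: bigcup_sup|left|right].
    - by exists A; split;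
        [exact: FP|exact: bigcup_sup|right|left].
    - have [AB|BA] := totF _ _ FA FB.
        by exists B; split;
          [exact: FP|exact: bigcup_sup|right; exact: AB|right].
      by exists A; split;
        [exact: FP|exact: bigcup_sup|right|right; exact: BA].
  split; last first.
    by move=> U1; have [A [[_ nA1] _ A1 _]] := in_chain _ _ U1 U1.
  apply/submoduleP; split; first by left; exact: submodule0.
  move=> a u v Uu Uv; have [A [[sA _] AU Au Av]] := in_chain _ _ Uu Uv.
  exact: (setUS AU) (submoduleZD a sA Au Av).
exists (L `|` I); last exact: subsetUl.
split=> //; first by move=> eqT; apply: nLI1; rewrite eqT.
move=> K sK LIK; have [K1|nK1] := pselect (K 1).
  by right; exact: right_ideal1.
have LK : L `|` K = K by apply/setUidPr => x Lx; apply: LIK; left.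
(* Maximality was obtained for [I], not for its union with [L]. As [K] absorbs [L], it satisfies [P]
   itself, and it would strictly contain [I]. *)
left; apply: contrapT => KLI; apply: (maxI K); last by rewrite /P LK.
split=> [x Ix|KI]; first by apply: LIK; right.
by apply: KLI; apply/seteqP; split=> // x /KI; right.
Qed.

Lemma submodule_jacobson : submodule (jacobson_radical R : set (rreg R)).
Proof.
apply/submoduleP; split=> [I [sI _ _]|a u v Ju Jv I maxI].
  exact: submodule0.
by case: (maxI) => sI _ _; apply: submoduleZD => //; [exact: Ju|exact: Jv].
Qed.

(** A proper [L] lies in some maximal right ideal, which also contains the Jacobson radical and
    hence the sum of the two. *)
Lemma jacobson_delta_small :
  delta_small (jacobson_radical R : set (rreg R)).
Proof.
split=> [|L sL JL_T _]; first exact: submodule_jacobson.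
apply: contrapT => /(proper_sub_maximal sL)[I maxI LI].
have [sI IT _] := maxI; apply: IT; apply/seteqP; split=> // x _.
have [y Jy [z Lz <-]] : [set x + y | x in jacobson_radical R & y in L] x.
  by rewrite JL_T.
exact: (@submoduleD _ (rreg R) _ _ _ sI (Jy I maxI) (LI z Lz)).
Qed.

Lemma jacobson_sub_zhou : jacobson_radical R `<=` zhou_radical R.
Proof. exact: (@sub_sum_family _ (rreg R) _ _ jacobson_delta_small). Qed.

Lemma socle_sub_maximal_essential I :
  right_socle R `<=` I -> maximal_submodule I -> essential I.
Proof.
move=> SI maxI; have [sI _ _] := maxI; split=> // K sK KI0.
apply: contrapT => K0; apply: (K0); rewrite -KI0; apply/esym/setIidl.
apply: subset_trans SI; apply: (@sub_sum_family _ (rreg R)).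
exact: maximal_complement_minimal maxI sK K0 KI0.
Qed.

Lemma delta_small_sub_maximal N I :
  delta_small N -> maximal_submodule I -> essential I -> N `<=` I.
Proof.
move=> [sN smallN] maxI essI; apply: contrapT => nNI; case: (maxI) => sI IT _.
by apply: IT; apply: smallN; [|exact: maximal_addT|exact: essential_singular_quotient].
Qed.

Lemma zhou_sub_jacobson :
  right_socle R `<=` jacobson_radical R ->
  zhou_radical R `<=` jacobson_radical R.
Proof.
move=> SJ; apply: (@sum_family_sub _ (rreg R)); first exact: submodule_jacobson.
move=> N smallN x Nx I maxI; apply: delta_small_sub_maximal Nx => //.
by apply: socle_sub_maximal_essential => // y /SJ; apply.
Qed.

End RightIdeals.

Unset Implicit Arguments.
Set Strict Implicit.

Theorem proposition2p6 (R : pzRingType)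
    (hS : right_socle R `<=` jacobson_radical R) :
  delta_reversible R <-> J_reversible R.
Proof.
split=> revR a b /revR; first exact: zhou_sub_jacobson.
exact: jacobson_sub_zhou.
Qed.
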